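(* For every integer $k>0$, $$\lim_{C\to\infty}\ \limsup_{q\to\infty}\ \mathbb{P}\bigl(\mathrm{Diam}(q,k) > C\, q^{1/k}\bigr) = 0,$$ where $q$ ranges over the prime numbers and $\mathrm{Diam}(q,k)$ is the diameter of the directed Cayley graph of the cyclic group $\mathbb{Z}_q$ with respect to $k$ generators $g_1,\dots,g_k$ chosen independently and uniformly at random from $\mathbb{Z}_q$.
   Context: For a finite group $G$ and a subset $S\subseteq G$, the (directed) Cayley graph of $G$ with respect to $S$ is the graph with vertex set $G$ and edge set $E$ where $(g,h)\in E$ if and only if $h^{-1}g\in S$. For a prime $q$, $\mathbb{Z}_q$ is the (additive) cyclic group of order $q$. Let $g_1,\dots,g_k$ be independent and uniformly distributed on $\mathbb{Z}_q$. $\mathrm{Diam}(q,k)$ is the random variable equal to the diameter of the directed Cayley graph of $\mathbb{Z}_q$ with respect to $\{g_1,\dots,g_k\}$, i.e. the maximum over ordered pairs of vertices of the directed graph distance. Convention: the diameter is $+\infty$ if some vertex is not reachable from another, which happens only when all $g_i=0$. *)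

(* Defs.v *)
From HB Require Import structures.
From mathcomp Require Import all_boot all_order all_fingroup all_algebra.
From mathcomp Require Import all_classical all_reals all_analysis.
Import numFieldNormedType.Exports.

Set Implicit Arguments.
Unset Strict Implicit.
Unset Printing Implicit Defensive.

Import Order.TTheory GRing.Theory Num.Theory.

Local Open Scope classical_set_scope.
Local Open Scope ring_scope.

Section DirectedGraph.
Variables (R : realType) (V : finType) (e : rel V).

(* The infimum of the empty set is +oo: this is the distance to an
   unreachable vertex. *)
Definition digraph_dist (x y : V) : \bar R :=
  ereal_inf [set (size p)%:R%:E | p in [set p : seq V | path e x p /\ last x p = y]].

Definition digraph_diam : \bar R :=
  (\big[maxe/-oo]_(x : V) \big[maxe/-oo]_(y : V) digraph_dist x y)%E.

End DirectedGraph.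

Definition cayley_rel (gT : finGroupType) (S : {set gT}) : rel gT :=
  fun g h => (h^-1 * g)%g \in S.

(* The group structure on 'Z_q is the additive one. *)
Definition Zq_diam (R : realType) (q k : nat) (g : 'I_k -> 'Z_q) : \bar R :=
  digraph_diam R (cayley_rel [set g i | i : 'I_k]%SET).

(* Discrete sigma-algebra on a nonempty ordinal type, so that random
   variables can take values in 'Z_q. *)
HB.instance Definition _ (n : nat) := isPointed.Build 'I_n.+1 ord0.

HB.instance Definition _ (n : nat) := @isMeasurable.Build
  default_measure_display 'I_n.+1 discrete_measurable discrete_measurable0
  discrete_measurableC discrete_measurableU.

Definition mutually_independent (d d' : measure_display) (T : measurableType d)
    (T' : measurableType d') (R : realType) (P : probability T R)
    (I : finType) (X : I -> {RV P >-> T'}) : Prop :=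
  forall (J : {set I}) (B : I -> set T'), (forall i, measurable (B i)) ->
    P (\bigcap_(i in [set` J]) (X i @^-1` B i)) =
    (\prod_(i in J) P (X i @^-1` B i))%E.

(* Main.v *)
Require Import Defs.
From HB Require Import structures.
From mathcomp Require Import all_boot all_order all_fingroup all_algebra.
From mathcomp Require Import all_classical all_reals all_analysis.
From mathcomp Require Import zify ring lra.
Import numFieldNormedType.Exports.
Import Order.TTheory GRing.Theory Num.Theory.

(* Second moment method. Call [a] represented by [g_1, .., g_k] if it is a sum
   [\sum_i x_i g_i] with all [x_i < m]. If [m <= q], two distinct coefficient
   vectors represent the same element with probability [1/q]; this controls
   the variance over [a] of the number of representations of [a], and by
   Chebyshev the expected number of elements not represented is at most
   [q * (q / m^k)]. Hence with probability at least [1 - 2 q / m^k] more than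
   half of [Z_q] is represented; by pigeonhole every element is then a sum of
   two represented ones, and the diameter is at most [2 k m]. Take [m] to be about [C q^(1/k) / 2k].
   For [k = 1] the requirement [m <= q] is too strong, but there any nonzero
   generator reaches everything in [q] steps. *)

Set Implicit Arguments.
Unset Strict Implicit.
Unset Printing Implicit Defensive.

Local Open Scope ring_scope.

(** * Counting representations with bounded coefficients *)

Section Counting.
Variables (A : finComUnitRingType) (k : nat).
Implicit Type f : {ffun 'I_k -> A}.

(** Adding [c / v j] to coordinate [j] maps the kernel of the linear form bijectively onto its fiber
    over [c], so all [#|A|] fibers have the same size. *)
Lemma card_hyperplane (v : 'I_k -> A) (j : 'I_k) : v j \is a GRing.unit ->
  (#|A| * #|[set f : {ffun 'I_k -> A} | \sum_i f i * v i == 0]%R| = #|A| ^ k)%N.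
Proof.
move=> vj; rewrite -sum_nat_const -[in RHS](card_ord k) -card_ffun -[RHS]sum1_card.
rewrite [RHS](partition_big
  (fun f : {ffun _ -> A} => \sum_i f i * v i) predT) //=.
apply: eq_bigr => c _.
pose s f := f + [ffun i => if i == j then c / v j else 0] : {ffun 'I_k -> A}.
have s_inj : injective s by exact: addIr.
rewrite sum1dep_card -[LHS](card_imset _ s_inj).
have sum_s f : \sum_i s f i * v i = \sum_i f i * v i + c.
  under eq_bigr do rewrite !ffunE mulrDl.
  rewrite big_split /=; congr +%R; rewrite (bigD1 j) //= eqxx divrK //.
  by rewrite big1 ?addr0 // => i /negPf ->; rewrite mul0r.
apply: eq_card => f; rewrite !inE; apply/imsetP/eqP => [[h]|fc].
  by rewrite inE => /eqP h0 ->; rewrite sum_s h0 add0r.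
exists (f - [ffun i => if i == j then c / v j else 0]); last by rewrite /s subrK.
by rewrite inE -(addrK c (\sum_i _)) -sum_s /s subrK fc subrr.
Qed.

Variable m : nat.
Hypothesis unit_lt : forall n : nat, (0 < n < m)%N -> n%:R \is a @GRing.unit A.

Let box := {ffun 'I_k -> 'I_m}.
Definition lincomb f (x : box) : A := \sum_i f i *+ x i.
Definition sums f : {set A} := [set lincomb f x | x : box].
Definition nrep f (a : A) : nat := #|[set x : box | lincomb f x == a]|.

Lemma sum_nrep f : (\sum_a nrep f a = m ^ k)%N.
Proof.
transitivity #|box|; last by rewrite card_ffun !card_ord.
rewrite -sum1_card (partition_big (lincomb f) predT) //=.
by apply: eq_bigr => a _; rewrite sum1dep_card.
Qed.

(** Some coordinate of [x - y] is nonzero and below [m] in absolute value, hence a unit by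
    [unit_lt]; colliding is then a hyperplane condition on [f]. *)
Lemma card_collision (x y : box) : x != y ->
  (#|A| * #|[set f | lincomb f x == lincomb f y]| = #|A| ^ k)%N.
Proof.
move=> neq_xy; have [j neq_j] : exists j, x j != y j.
  apply/existsP; rewrite -negb_forall; apply: contra neq_xy => /forallP xy.
  by apply/eqP/ffunP => i; apply/eqP.
rewrite -(@card_hyperplane (fun i => (x i)%:R - (y i)%:R) j).
  congr (_ * _)%N; apply: eq_card => f; rewrite !inE -subr_eq0 /lincomb -sumrB.
  by congr (_ == _); apply: eq_bigr => i _; rewrite mulrBr !mulr_natr.
have [le_xy|/ltnW le_yx] := leqP (x j) (y j).
  rewrite -opprB unitrN -natrB // unit_lt //.
  have := ltn_ord (y j); move: neq_j le_xy; rewrite -val_eqE /=; lia.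
rewrite -natrB // unit_lt //.
by have := ltn_ord (x j); move: neq_j le_yx; rewrite -val_eqE /=; lia.
Qed.

Lemma sum_sqr_nrep f :
  (\sum_a nrep f a ^ 2
   = \sum_(x : box) \sum_(y : box) (lincomb f x == lincomb f y))%N.
Proof.
transitivity (\sum_(x : box) nrep f (lincomb f x))%N.
  rewrite [RHS](partition_big (lincomb f) predT) //=.
  apply: eq_bigr => a _.
  rewrite (eq_bigr (fun=> nrep f a)) => [|x /eqP-> //].
  by rewrite sum_nat_const -mulnn /nrep cardsE.
apply: eq_bigr => x _; rewrite /nrep -sum1dep_card big_mkcond /=.
by apply: eq_bigr => y _; rewrite eq_sym; case: eqP.
Qed.

(** Diagonal pairs collide for every [f]; the others are counted by [card_collision]. The factor
    [#|A|] avoids division in [nat]. *)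
Lemma second_moment :
  (#|A| * (\sum_f \sum_a nrep f a ^ 2)
   = m ^ k * (#|A| * #|A| ^ k) + m ^ k * (m ^ k).-1 * #|A| ^ k)%N.
Proof.
have card_box : #|box| = (m ^ k)%N by rewrite card_ffun !card_ord.
rewrite (eq_bigr _ (fun f _ => sum_sqr_nrep f)) exchange_big /= big_distrr /=.
rewrite -mulnA -mulnDr -card_box -sum_nat_const; apply: eq_bigr => x _.
rewrite exchange_big /= (bigD1 x) //= mulnDr; congr addn.
  rewrite (eq_bigr (fun=> 1%N)) => [|f _]; last by rewrite eqxx.
  by rewrite sum_nat_const muln1 card_ffun card_ord.
rewrite big_distrr /= (eq_bigr (fun=> #|A| ^ k)%N) => [|y].
  by rewrite sum_nat_const; congr muln; rewrite (cardC1 x).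
rewrite eq_sym => /card_collision <-; congr muln.
rewrite -sum1dep_card [RHS]big_mkcond /=.
by apply: eq_bigr => f _; case: eqP.
Qed.

(* Each missed [a] contributes [(m ^ k) ^ 2] to the sum over [a] of
   [(#|A| * nrep f a - m ^ k) ^ 2]. *)
Lemma missed_le f :
  ((m ^ k) ^ 2 * #|~: sums f| + #|A| * (m ^ k) ^ 2
   <= #|A| ^ 2 * \sum_a nrep f a ^ 2)%N.
Proof.
suff : ((m ^ k) ^ 2 * #|~: sums f|)%:Z <=
    #|A|%:Z ^+ 2 * (\sum_a nrep f a ^ 2)%N%:Z - #|A|%:Z * (m ^ k)%N%:Z ^+ 2.
  by lia.
have -> : #|A|%:Z ^+ 2 * (\sum_a nrep f a ^ 2)%N%:Z - #|A|%:Z * (m ^ k)%N%:Z ^+ 2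
    = \sum_a (#|A|%:Z * (nrep f a)%:Z - (m ^ k)%N%:Z) ^+ 2.
  have -> : \sum_a (#|A|%:Z * (nrep f a)%:Z - (m ^ k)%N%:Z) ^+ 2 =
     \sum_a (#|A|%:Z ^+ 2 * (nrep f a ^ 2)%N%:Z
        + (- 2 * #|A|%:Z * (m ^ k)%N%:Z) * (nrep f a)%:Z
        + (m ^ k)%N%:Z ^+ 2).
    by apply: eq_bigr => a _; rewrite PoszM; ring.
  rewrite !big_split /= -!big_distrr /= sumr_const.
  rewrite -!(big_morph Posz PoszD (erefl 0%:Z)) sum_nrep.
  by rewrite -mulr_natl natz; ring.
rewrite PoszM -sum1_card (big_morph Posz PoszD (erefl 0%:Z)) big_distrr /=.
rewrite [leRHS](bigID (mem (~: sums f))) /= -[leLHS]addr0 lerD //; last first.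
  by apply: sumr_ge0 => a _; exact: sqr_ge0.
apply: ler_sum => a; rewrite inE => /imsetP aNS.
suff -> : nrep f a = 0%N by rewrite mulr0 sub0r sqrrN mulr1 PoszM.
apply/eqP; rewrite cards_eq0; apply/eqP/setP => x; rewrite !inE.
by apply/eqP => xa; apply: aNS; exists x.
Qed.

Lemma card_few_sums : (0 < m)%N ->
  (m ^ k * #|[set f | 2 * #|sums f| <= #|A|]| <= 2 * #|A| ^ k.+1)%N.
Proof.
move=> m_gt0.
have A_gt0 : (0 < #|A|)%N by apply/card_gt0P; exists 0.
have M_gt0 : (0 < m ^ k)%N by rewrite expn_gt0 m_gt0.
set B := [set f | _].
(* After [missed_le] is summed over [f], the terms of order [(m ^ k) ^ 2] on the right cancel
   against the left, and one factor [m ^ k] divides out. *)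
have missed : (\sum_f #|~: sums f| * m ^ k <= #|A| ^ k.+2)%N.
  have : (\sum_f ((m ^ k) ^ 2 * #|~: sums f| + #|A| * (m ^ k) ^ 2)
      <= \sum_f (#|A| ^ 2 * \sum_a nrep f a ^ 2))%N.
    by apply: leq_sum => f _; exact: missed_le.
  rewrite big_split /= -!big_distrr /= sum_nat_const card_ffun card_ord.
  have -> P : (#|A| ^ 2 * P = #|A| * (#|A| * P))%N by rewrite mulnA mulnn.
  rewrite second_moment -big_distrl /= !expnS.
  move: (\sum_f _)%N (#|A| ^ k)%N => U q UM.
  rewrite -(leq_pmul2l M_gt0); move: M_gt0 UM.
  case: (m ^ k)%N => // M _ /=; move: #|A| => a; rewrite expn0 => UM. lia.
(* Markov's inequality: each [f] in [B] misses at least half of [A]. *)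
have : (#|B| * #|A| <= 2 * \sum_f #|~: sums f|)%N.
  rewrite -sum_nat_const big_distrr /= [leqRHS](bigID (mem B)) /=.
  apply: leq_trans (leq_addr _ _); apply: leq_sum => f; rewrite inE => Bf.
  by move: Bf; rewrite -(cardsC (sums f)) !mul2n -!addnn leq_add2l leq_add2r.
move: missed; rewrite -big_distrl /= !expnS.
move: (\sum_f _)%N (#|A| ^ k)%N => U q missed BU.
rewrite -(leq_pmul2l A_gt0).
have := leq_mul (leqnn (m ^ k)) BU; move: #|A| missed => a missed; lia.
Qed.
(** For [k = 1], only one [f] makes two given distinct vectors collide, and [0] is such an [f]; so a
    nonzero [f] makes [lincomb f] injective. *)
Lemma card_sums_rank1 f : k = 1%N -> f != 0 -> #|sums f| = m.
Proof.
move=> k1 f_neq0; rewrite card_imset => [|x y xy].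
  by rewrite card_ffun !card_ord k1 expn1.
apply/eqP; apply: contraNT f_neq0 => /card_collision.
rewrite [in RHS]k1 expn1 -[in RHS](muln1 #|A|) => /eqP.
rewrite eqn_pmul2l; last by apply/card_gt0P; exists 0.
case/cards1P => h Eh; have in_h u : lincomb u x = lincomb u y -> u = h.
  by move=> uxy; apply/set1P; rewrite -Eh inE uxy.
rewrite (in_h f xy) -(in_h 0) // /lincomb.
by rewrite !big1 // => i _; rewrite ffunE mul0rn.
Qed.
End Counting.

(** * From many represented elements to a small diameter *)

Local Open Scope classical_set_scope.
Local Open Scope ring_scope.

(** [B] and [z - B] each fill more than half of [G], so they meet. *)
Lemma sumset_full (G : finZmodType) (B : {set G}) (z : G) :
  (#|G| < 2 * #|B|)%N -> exists2 a, a \in B & z - a \in B.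
Proof.
move=> B_big; have inj_z : injective (fun a : G => z - a).
  by move=> a b /addrI /oppr_inj.
pose B' := [set z - a | a in B]%SET.
have : (0 < #|B :&: B'|)%N.
  have := max_card (B :|: B'); have := cardsUI B B'.
  rewrite card_imset // => UI U.
  rewrite -(ltn_add2l #|B :|: B'|) UI addn0; apply: leq_ltn_trans U _.
  by rewrite addnn -mul2n.
case/card_gt0P => b; rewrite inE => /andP[bB /imsetP[a aB b_za]].
by exists a; rewrite // -b_za.
Qed.

Section Diameter.
Variables (R : realType) (q k : nat) (g : 'I_k -> 'Z_q).

Let e := cayley_rel [set g i | i : 'I_k]%SET.

(** An edge from [g] to [h] means that [g - h] is a generator, so every step of a walk subtracts
    one. *)
Lemma cayley_walk (s : seq 'I_k) (x : 'Z_q) : exists p : seq 'Z_q,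
  [/\ path e x p, last x p = x - \sum_(i <- s) g i & size p = size s].
Proof.
elim: s x => [|i s IHs] x; first by exists [::]; rewrite big_nil subr0.
have [p [ep lastp sizep]] := IHs (x - g i); exists (x - g i :: p).
split => /=; last by rewrite sizep.
  rewrite ep andbT /e /cayley_rel FinRing.zmodVgE FinRing.zmodMgE opprB subrK.
  exact: imset_f.
by rewrite lastp big_cons opprD addrA.
Qed.

Lemma digraph_dist_le (n : 'I_k -> nat) (x y : 'Z_q) :
  x - y = \sum_i g i *+ n i -> (digraph_dist R e x y <= (\sum_i n i)%:R%:E)%E.
Proof.
pose s := flatten [seq nseq (n i) i | i <- enum 'I_k].
have [p [ep lastp sizep]] := cayley_walk s x.
move=> xy; apply: ereal_inf_lbound; exists p.
  split=> //; rewrite lastp /s big_flatten big_map big_enum /=.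
  under eq_bigr do rewrite big_nseq iter_addr_0.
  by rewrite -xy subKr.
rewrite sizep /s size_flatten sumnE /shape 2!big_map big_enum /=.
by under eq_bigr do rewrite size_nseq.
Qed.

(** [x - y] is a sum of two represented elements, each costing at most [k * m] steps. *)
Lemma Zq_diam_le (m : nat) :
  (#|'Z_q| < 2 * #|sums m [ffun i => g i]|)%N ->
  (Zq_diam R g <= (2 * (k * m))%:R%:E)%E.
Proof.
move=> sums_big.
apply: bigmax_le => [|x _]; first exact: leNye.
apply: bigmax_le => [|y _]; first exact: leNye.
have [a /imsetP[u _ a_u] /imsetP[v _ b_v]] := sumset_full (x - y) sums_big.
have /digraph_dist_le/le_trans -> // :
    x - y = \sum_i g i *+ (u i + v i).
  rewrite -(subrK a (x - y)) b_v a_u -big_split /=.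
  by apply: eq_bigr => i _; rewrite ffunE mulrnDr addrC.
rewrite lee_fin ler_nat big_split /= mul2n -addnn.
have le_km (w : {ffun 'I_k -> 'I_m}) : (\sum_i w i <= k * m)%N.
  rewrite -[X in (X * _)%N](card_ord k) -sum_nat_const.
  by apply: leq_sum => i _; exact: ltnW.
by rewrite leq_add.
Qed.
End Diameter.

(** * Law of the random generator tuple *)

Section UniformTuple.
Context (R : realType) (q k : nat) (d : measure_display) (T : measurableType d).
Variables (P : probability T R) (X : 'I_k -> {RV P >-> 'Z_q}).
Hypothesis X_unif : forall i a, distribution P (X i) [set a] = (q%:R^-1)%:E.
Hypothesis X_indep : mutually_independent X.

(** An intersection over the full index set is the shape to which [X_indep] applies. *)
Let fiber (f : {ffun 'I_k -> 'Z_q}) : set T :=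
  \bigcap_(i in [set` [set: 'I_k]%SET]) (X i @^-1` [set f i]).

Lemma fiberE f : fiber f = [set w | [ffun i => X i w] = f].
Proof.
apply/seteqP; split=> w /=.
  by move=> Xf; apply/ffunP => i; rewrite ffunE; apply: Xf; rewrite /= inE.
by move=> <- i _ /=; rewrite ffunE.
Qed.

Lemma measurable_fiber f : measurable (fiber f).
Proof.
apply: fin_bigcap_measurable => // i _.
by rewrite -[X in measurable X]setTI; exact: measurable_funP.
Qed.

Lemma prob_fiber f : P (fiber f) = (q%:R^-1 ^+ k)%:E.
Proof.
rewrite (X_indep [set: 'I_k]%SET (fun i => _)) //.
rewrite (eq_bigr (fun=> (q%:R^-1)%:E)) => [|i _]; last exact: X_unif.
by rewrite prodEFin big_const /= cardsT card_ord iter_mulr_1.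
Qed.

(** The event is a finite disjoint union of fibers, all of the same probability. *)
Lemma prob_uniform_tuple (B : {set {ffun 'I_k -> 'Z_q}}) :
  P [set w | [ffun i => X i w] \in B] = (#|B|%:R * q%:R^-1 ^+ k)%:E.
Proof.
have -> : [set w | [ffun i => X i w] \in B] = \bigcup_(f in [set` B]) fiber f.
  apply/seteqP; split=> w /=.
    by move=> wB; exists [ffun i => X i w]; rewrite ?fiberE.
  by move=> [f fB]; rewrite fiberE /= => ->.
rewrite measure_fin_bigcup //; first last.
- by move=> f _; exact: measurable_fiber.
- by move=> f h _ _ [w []]; rewrite !fiberE /= => -> ->.
have -> : [set` B] = [set` enum B].
  by apply/seteqP; split=> f /=; rewrite mem_enum.
rewrite -fsbig_seq ?enum_uniq // big_enum /=.
under eq_bigr do rewrite prob_fiber.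
by rewrite sumEFin sumr_const mulr_natl.
Qed.
End UniformTuple.

(** * Tail bound for a fixed prime *)

Lemma natr_Zp_unit (q m : nat) : prime q -> (m <= q)%N ->
  forall n : nat, (0 < n < m)%N -> n%:R \is a @GRing.unit 'Z_q.
Proof.
move=> q_pr le_mq n /andP[n_gt0 lt_nm]; rewrite unitZpE ?prime_gt1 //.
by rewrite prime_coprime // gtnNdvd // (leq_trans lt_nm).
Qed.

Section TailBound.
Context (R : realType) (q k : nat) (d : measure_display) (T : measurableType d).
Variables (P : probability T R) (X : 'I_k -> {RV P >-> 'Z_q}).
Hypotheses (k_gt0 : (0 < k)%N) (q_pr : prime q).
Hypothesis X_unif : forall i a, distribution P (X i) [set a] = (q%:R^-1)%:E.
Hypothesis X_indep : mutually_independent X.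

Let few (m : nat) :=
  [set f : {ffun 'I_k -> 'Z_q} | (2 * #|sums m f| <= #|'Z_q|)%N]%SET.

(** By [Zq_diam_le], a diameter above [D] forces the tuple into [few m], which reduces the
    probability to a count. *)
Lemma prob_diam_gt (D : R) (m : nat) : (2 * (k * m))%:R <= D ->
  (P [set w | D%:E < Zq_diam R (fun i => X i w)]
   <= (#|few m|%:R * q%:R^-1 ^+ k)%:E)%E.
Proof.
move=> le_mD.
pose large := [set f : {ffun 'I_k -> 'Z_q} | D%:E < Zq_diam R f]%E%SET.
have -> : [set w | D%:E < Zq_diam R (fun i => X i w)]%E =
    [set w | [ffun i => X i w] \in large].
  apply/seteqP; split=> w /=; rewrite inE => Dw;
    by congr (_ < Zq_diam R _)%E: Dw; apply/funext => i; rewrite ffunE.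
rewrite prob_uniform_tuple // lee_fin ler_wpM2r ?exprn_ge0 ?invr_ge0 //.
rewrite ler_nat subset_leq_card //. apply/fintype.subsetP => f; rewrite !inE.
apply: contraTT; rewrite -ltnNge -leNgt => f_many.
apply: le_trans (Zq_diam_le _ (m := m) _) _; last by rewrite lee_fin.
by have -> : [ffun i => f i] = f by apply/ffunP => i; rewrite ffunE.
Qed.

Lemma prob_diam_tail (C : R) : 4 * k%:R <= C -> C ^+ 2 <= q%:R ->
  (P [set w | (C * q%:R `^ k%:R^-1)%:E < Zq_diam R (fun i => X i w)]
   <= (8 * k%:R / C)%:E)%E.
Proof.
move=> le_kC le_Cq.
have cardZ : #|'Z_q| = q by rewrite card_ord Zp_cast ?prime_gt1.
have k_ge1 : 1 <= k%:R :> R by rewrite ler1n.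
have q_gt0 : 0 < q%:R :> R by rewrite ltr0n prime_gt0.
have C_gt0 : 0 < C by lra.
(* For [k = 1] take [m = q]: only the zero tuple lies in [few q], and [1 / q <= 8 / C] because
   [C <= C ^+ 2 <= q]. *)
have [k1|k_neq1] := eqVneq k 1%N.
  apply: le_trans (prob_diam_gt (m := q) _) _.
    by rewrite k1 invr1 powRr1 ?ler0n // mul1n natrM ler_wpM2r ?ler0n //; lra.
  have few_le1 : (#|few q| <= 1)%N.
    rewrite -(cards1 (0 : {ffun 'I_k -> 'Z_q})) subset_leq_card //.
    apply/fintype.subsetP => f; rewrite !inE; apply: contraTT => f_neq0.
    rewrite (card_sums_rank1 (natr_Zp_unit q_pr (leqnn q))) // cardZ -ltnNge.
    by rewrite mul2n -addnn -[X in (X < _)%N]addn0 ltn_add2l prime_gt0.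
  rewrite lee_fin; apply: (@le_trans _ _ (1 * q%:R^-1)).
    by rewrite [in X in _ ^+ X]k1 expr1 ler_wpM2r ?invr_ge0 ?ler0n // lern1.
  rewrite mul1r ler_pdivlMr // mulrC ler_pdivrMr //.
  nra.
have k_gt1 : (1 < k)%N by lia.
pose D := C * q%:R `^ k%:R^-1.
have root_ge1 : 1 <= q%:R `^ k%:R^-1 :> R.
  rewrite -[leLHS](powRr0 q%:R) ler_powR ?invr_ge0 // ler1n prime_gt0 //.
(* Both factors of [D] are at most the square root of [q]: [C] by hypothesis, the [k]-th root
   because [k >= 2]. *)
have le_Dq : D <= q%:R.
  have sqrt_ge0 := sqrtr_ge0 (q%:R : R).
  rewrite -[leRHS]sqr_sqrtr ?ler0n // expr2 ler_pM ?powR_ge0 //.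
  - exact: ltW.
  - by rewrite -(ler_pXn2r (n := 2)) ?nnegrE ?sqr_sqrtr ?ler0n // ltW.
  rewrite -powR12_sqrt ?ler0n // ler_powR ?ler1n ?prime_gt0 //.
  by rewrite lef_pV2 ?posrE ?ltr0n // ler_nat.
(* [m] is the largest integer with [2 * k * m <= D]. *)
pose t := D / (2 * k%:R); pose m := Num.truncn t.
have D_ge : 4 * k%:R <= D by rewrite /D; nra.
have t_ge1 : 1 <= t by rewrite ler_pdivlMr; lra.
have m_gt0 : (0 < m)%N by rewrite truncn_gt0.
have le_mt : m%:R <= t by rewrite truncn_le; lra.
have lt_tm : t < m%:R + 1 by rewrite natr1 truncnS_gt.
have m_ge1 : 1 <= m%:R :> R by rewrite ler1n.
have tE : t * (2 * k%:R) = D by rewrite divfK //; lra.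
have le_mq : (m <= q)%N by rewrite -(ler_nat R); nra.
apply: le_trans (prob_diam_gt (m := m) _) _.
  by rewrite !natrM -[leRHS]tE; nra.
rewrite lee_fin exprVn ler_pdivrMr ?exprn_gt0 //.
have := card_few_sums k (natr_Zp_unit q_pr le_mq) m_gt0.
rewrite -/(few m) cardZ -(ler_nat R) !natrM !natrX => few_le.
(* Rounding down loses at most a factor 2, so [m >= t / 2]; since [C / (4 * k) >= 1], its [k]-th
   power is at least itself. *)
have mk_ge : C / (4 * k%:R) * q%:R <= m%:R ^+ k.
  have -> : q%:R = (q%:R `^ k%:R^-1) ^+ k :> R.
    by rewrite -powR_mulrn ?powR_ge0 // -powRrM mulVf ?powRr1 ?ler0n //; lra.
  apply: (@le_trans _ _ ((C / (4 * k%:R)) ^+ k * (q%:R `^ k%:R^-1) ^+ k)).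
    rewrite ler_wpM2r ?exprn_ge0 ?powR_ge0 // -[leLHS]expr1 ler_weXn2l //.
    by rewrite ler_pdivlMr; lra.
  rewrite -exprMn lerXn2r ?nnegrE ?mulr_ge0 ?powR_ge0 ?divr_ge0 //; try lra.
  have -> : C / (4 * k%:R) * q%:R `^ k%:R^-1 = t / 2.
    by rewrite /t /D; field; lra.
  lra.
have : C / (4 * k%:R) * q%:R * #|few m|%:R <= 2 * q%:R ^+ k.+1.
  by apply: le_trans few_le; rewrite ler_wpM2r.
rewrite exprS.
have -> : C / (4 * k%:R) * q%:R * #|few m|%:R
    = q%:R * ((C / (4 * k%:R)) * #|few m|%:R) by ring.
rewrite [2 * _]mulrCA ler_pM2l // => H.
have -> : #|few m|%:R
    = (4 * k%:R / C) * (C / (4 * k%:R) * #|few m|%:R) :> R by field; lra.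
have -> : 8 * k%:R / C * q%:R ^+ k = (4 * k%:R / C) * (2 * q%:R ^+ k).
  by field; lra.
by rewrite ler_wpM2l // divr_ge0; lra.
Qed.
End TailBound.

(** * Passage to the limit *)

Theorem theorem1 (R : realType) (k : nat) (k_gt0 : (0 < k)%N)
    (d : nat -> measure_display)
    (T : forall q : nat, measurableType (d q))
    (P : forall q : nat, probability (T q) R)
    (g : forall q : nat, 'I_k -> {RV (P q) >-> 'Z_q})
    (g_unif : forall q : nat, prime q -> forall (i : 'I_k) (a : 'Z_q),
      distribution (P q) (g q i) [set a] = (q%:R^-1)%:E)
    (g_indep : forall q : nat, prime q -> mutually_independent (g q)) :
  (fun C : R => limf_esup
     (fun q : nat => P q [set w : T q |
        ((C * q%:R `^ (k%:R^-1))%:E < Zq_diam R (fun i => g q i w))%E])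
     (within [set q | prime q] \oo))
  @ +oo --> 0%E.
Proof.
apply: (squeeze_cvge (f := cst 0%E) (h := fun C : R => (8 * k%:R / C)%:E)).
- near=> C; apply/andP; split.
    (* The primes are unbounded, so the filter is proper; otherwise the limsup would be [-oo]. *)
    apply: limf_esup_ge0 => [[N _ noprime]|q]; last exact: measure_ge0.
    have [q lt_Nq q_pr] := prime_above N.
    exact: (noprime q (ltnW lt_Nq) q_pr).
  (* The limsup is an infimum of suprema; it is bounded by the supremum over primes [q >= C ^+ 2],
     where the tail bound holds. *)
  apply: ereal_inf_le.
  exists (ereal_sup ((fun q : nat => P q [set w : T q |
    ((C * q%:R `^ (k%:R^-1))%:E < Zq_diam R (fun i => g q i w))%E])
     @` [set q | prime q /\ C ^+ 2 <= q%:R])).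
    exists [set q | prime q /\ C ^+ 2 <= q%:R] => //.
    exists (Num.truncn (C ^+ 2)).+1 => // q /= lt_q q_pr; split=> //.
    apply: ltW; apply: lt_le_trans (truncnS_gt _) _.
    by rewrite ler_nat.
  apply: ge_ereal_sup => _ [q [q_pr le_Cq] <-].
  apply: prob_diam_tail => //; [exact: g_unif | exact: g_indep].
- exact: cvg_cst.
- apply: cvg_EFin; first exact: nearW.
  apply/cvgr0Pnorm_le => e e_gt0; near=> C => /=.
  have C_gt0 : 0 < C by [].
  rewrite ger0_norm; last by rewrite divr_ge0 ?mulr_ge0 ?ler0n // ltW.
  by rewrite ler_pdivrMr // [e * _]mulrC -ler_pdivrMr.
Unshelve. all: by end_near.
Qed.
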